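(* Let $(M,d)$ be a complete cone metric space over a real Banach space $E$ with respect to a cone $P\subset E$ with $\operatorname{Int} P\neq\emptyset$, and suppose that $P$ is normal with normal constant $K$. Let $S,T:M\to M$ be mappings such that (a) $T$ is continuous; (b) $S(M)\subset T(M)$; (c) $(S,T)$ is a commuting pair, i.e. $STx=TSx$ for all $x\in M$; (d) there are nonnegative real numbers $a,b,c$ with $0<a+2b+2c<1$ such that for all $x,y\in M$ $$d(Sx,Sy)\leq a\, d(Tx,Ty)+b\,[d(Sx,Tx)+d(Sy,Ty)]+c\,[d(Sx,Ty)+d(Sy,Ty)].$$ Then $S$ and $T$ have a unique common fixed point, i.e. there is exactly one $z\in M$ with $Sz=Tz=z$.
   Context: Let $(E,\|\cdot\|)$ be a real Banach space. A subset $P\subset E$ is a cone if: $P$ is closed, nonempty and $P\neq\{0\}$; $ax+by\in P$ for all $x,y\in P$ and all real $a,b\ge 0$; and $P\cap(-P)=\{0\}$. A cone $P$ induces the partial order $x\le y\iff y-x\in P$ on $E$; $x<y$ means $x\le y$ and $x\ne y$; $x\ll y$ means $y-x\in\operatorname{Int}P$, the interior of $P$. It is always assumed that $\operatorname{Int}P\neq\emptyset$. The cone $P$ is normal if there is $K>0$ such that $0\le x\le y$ implies $\|x\|\le K\|y\|$ for all $x,y\in E$; the least such positive $K$ is the normal constant of $P$. A cone metric space (over $E$, $P$) is a nonempty set $M$ with a map $d:M\times M\to E$ such that for all $x,y,z\in M$: $0\le d(x,y)$, with $d(x,y)=0$ iff $x=y$; $d(x,y)=d(y,x)$; $d(x,y)\le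 d(x,z)+d(z,y)$. A sequence $(x_n)$ in $M$ converges to $x\in M$ if for every $c\in E$ with $0\ll c$ there is a positive integer $n_0$ such that $d(x_n,x)\ll c$ for all $n\ge n_0$; it is Cauchy if for every $c\in E$ with $0\ll c$ there is a positive integer $n_0$ such that $d(x_n,x_m)\ll c$ for all $n,m\ge n_0$. $(M,d)$ is complete if every Cauchy sequence converges in $M$. Continuity of maps $M\to M$ is with respect to the topology on $M$ having as sub-basis the sets $B(b,c)=\{y\in M: d(y,b)\ll c\}$, with $b\in M$ and $c\in E$, $0\ll c$. *)

(* Defs.v *)
From HB Require Import structures.
From mathcomp Require Import all_boot all_order all_algebra.
From mathcomp Require Import all_classical all_reals all_analysis.
Set Implicit Arguments.
Unset Strict Implicit.
Unset Printing Implicit Defensive.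
Import Order.TTheory GRing.Theory Num.Theory.
Import numFieldNormedType.Exports.
Local Open Scope classical_set_scope.
Local Open Scope ring_scope.

Section Cone.
Context {R : realType} {E : completeNormedModType R}.
Implicit Types (P : set E) (x y : E) (K : R).

Record is_cone P : Prop := IsCone {
  cone_closed : closed P;
  cone_nonempty : P !=set0;
  cone_neq0 : P <> [set 0];
  cone_comb : forall x y (a b : R),
    P x -> P y -> 0 <= a -> 0 <= b -> P (a *: x + b *: y);
  cone_pointed : P `&` [set - x | x in P] = [set 0]
}.

Definition cone_le P x y : Prop := P (y - x).

Definition cone_ll P x y : Prop := interior P (y - x).

Definition normal_bound P K : Prop :=
  0 < K /\ forall x y, cone_le P 0 x -> cone_le P x y -> `|x| <= K * `|y|.

Definition normal_cone P : Prop := exists K, normal_bound P K.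

Definition normal_constant P K : Prop :=
  normal_bound P K /\ forall K', normal_bound P K' -> K <= K'.

End Cone.

Section ConeMetric.
Context {R : realType} {E : completeNormedModType R} {M : Type}.
Variables (P : set E) (d : M -> M -> E).

Record is_cone_metric : Prop := IsConeMetric {
  cone_metric_nonempty : [set: M] !=set0;
  cone_metric_ge0 : forall x y, cone_le P 0 (d x y);
  cone_metric_eq0 : forall x y, d x y = 0 <-> x = y;
  cone_metric_sym : forall x y, d x y = d y x;
  cone_metric_triangle : forall x y z, cone_le P (d x y) (d x z + d z y)
}.

Definition cone_cvg (u : nat -> M) (x : M) : Prop :=
  forall c : E, cone_ll P 0 c ->
    exists n0 : nat, forall n, (n0 <= n)%N -> cone_ll P (d (u n) x) c.

Definition cone_cauchy (u : nat -> M) : Prop :=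
  forall c : E, cone_ll P 0 c ->
    exists n0 : nat, forall n m, (n0 <= n)%N -> (n0 <= m)%N ->
      cone_ll P (d (u n) (u m)) c.

Definition cone_complete : Prop :=
  forall u : nat -> M, cone_cauchy u -> exists x : M, cone_cvg u x.

Definition cone_ball (b : M) (c : E) : set M := [set y | cone_ll P (d y b) c].

Definition cone_subbase : set (set M) :=
  [set B | exists (b : M) (c : E), cone_ll P 0 c /\ B = cone_ball b c].

End ConeMetric.

(* An alias of [M] that carries the topology generated by [cone_subbase P d],
   so that continuity is the library's [continuous]; [P] and [d] are phantom
   parameters that determine the topology. *)
Definition cone_top (R : realType) (E : completeNormedModType R) (M : Type)
  (P : set E) (d : M -> M -> E) : Type := M.

Section ConeTopology.
Context {R : realType} {E : completeNormedModType R} {M : Type}.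
Variables (P : set E) (d : M -> M -> E).

HB.instance Definition _ := gen_eqMixin (cone_top P d).
HB.instance Definition _ := gen_choiceMixin (cone_top P d).
HB.instance Definition _ := isSubBaseTopological.Build (cone_top P d)
  (cone_subbase P d : set (set (cone_top P d))) id.

Definition cone_continuous (f : M -> M) : Prop :=
  continuous (f : cone_top P d -> cone_top P d).

End ConeTopology.

(* Main.v *)
(* Choosing [T x_(n+1) = S x_n], the contraction gives
   [d(y_(n+1), y_(n+2)) <= k d(y_n, y_(n+1))] for [y_n = S x_n], with
   [k = (a + b) / (1 - b - c) < 1], so [y] is Cauchy, with limit [z].  By
   commutation [S y_n = T y_(n+1)], so both [T y_n] and [S y_n] tend to [T z];
   comparing [S y_n] with [S z] yields [d(Tz, Sz) <= (b + c) d(Tz, Sz)], whence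
   [S z = T z].  The contraction identifies any two points of coincidence
   [S x = T x], [S y = T y] with each other; applied to [z] and [S z] this makes
   [S z] a common fixed point, and it also gives uniqueness.  Limits in the
   cone order are handled by letting [e >> 0] shrink along a ray and using that
   the cone is closed. *)
Require Import Defs.
From HB Require Import structures.
From mathcomp Require Import all_boot all_order all_algebra.
From mathcomp Require Import all_classical all_reals all_analysis.
From mathcomp Require Import ring lra.
Set Implicit Arguments.
Unset Strict Implicit.
Unset Printing Implicit Defensive.
Import Order.TTheory GRing.Theory Num.Theory.
Import numFieldNormedType.Exports.
Local Open Scope classical_set_scope.
Local Open Scope ring_scope.

Section ConeOrder.
Context {R : realType} {E : completeNormedModType R} (P : set E).
Hypothesis hP : is_cone P.
Implicit Types (x y z e : E) (s t : R).

Lemma coneD x y : P x -> P y -> P (x + y).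
Proof.
move=> Px Py; rewrite -[x]scale1r -[y]scale1r.
exact: (cone_comb hP).
Qed.

Lemma coneZ t x : 0 <= t -> P x -> P (t *: x).
Proof.
move=> t0 Px; rewrite -[_ *: x]addr0 -(scale0r x).
exact: (cone_comb hP).
Qed.

Lemma cone0 : P 0.
Proof. by have [x Px] := cone_nonempty hP; rewrite -(scale0r x); exact: coneZ. Qed.

Lemma cone_le_refl x : cone_le P x x.
Proof. by rewrite /cone_le subrr; exact: cone0. Qed.

Lemma cone_le_trans y x z : cone_le P x y -> cone_le P y z -> cone_le P x z.
Proof.
by rewrite /cone_le => xy yz; rewrite -(subrKA y z); exact: coneD.
Qed.

Lemma cone_leD x y z w :
  cone_le P x y -> cone_le P z w -> cone_le P (x + z) (y + w).
Proof. by rewrite /cone_le => xy zw; rewrite opprD addrACA; exact: coneD. Qed.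

Lemma cone_leZ s x y : 0 <= s -> cone_le P x y -> cone_le P (s *: x) (s *: y).
Proof. by rewrite /cone_le => s0 xy; rewrite -scalerBr; exact: coneZ. Qed.

Lemma cone_le0 x : cone_le P 0 x -> cone_le P x 0 -> x = 0.
Proof.
rewrite /cone_le subr0 sub0r => Px PNx.
have : (P `&` [set - y | y in P]) x by split=> //; exists (- x); rewrite ?opprK.
by rewrite (cone_pointed hP).
Qed.

(** Moving [t *: x] to the left leaves [(1 - t) *: x] below [y], and the positive factor can be
    divided out. Every contraction estimate with the same distance on both sides is solved this
    way. *)
Lemma cone_le_absorb t x y : t < 1 ->
  cone_le P x (y + t *: x) -> cone_le P x ((1 - t)^-1 *: y).
Proof.
move=> t1; rewrite /cone_le => xy.
have t1' : 0 < 1 - t by rewrite subr_gt0.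
have -> : (1 - t)^-1 *: y - x = (1 - t)^-1 *: (y + t *: x - x).
  have -> : y + t *: x - x = y - (1 - t) *: x.
    by rewrite scalerBl scale1r opprB addrA.
  by rewrite scalerBr scalerA mulVf ?scale1r// gt_eqF.
by apply: coneZ => //; rewrite invr_ge0 ltW.
Qed.

Lemma cone_le_contract0 t x :
  t < 1 -> cone_le P 0 x -> cone_le P x (t *: x) -> x = 0.
Proof.
move=> t1 x0 xt; apply: cone_le0 => //.
by rewrite -(scaler0 _ (1 - t)^-1); apply: cone_le_absorb => //; rewrite add0r.
Qed.

(** Translation by [- y] is continuous, so [w - y] stays in [P] for [w] near [x + y]; adding [y]
    back keeps [w] in [P]. *)
Lemma interior_coneD x y : interior P x -> P y -> interior P (x + y).
Proof.
move=> Px Py; have c : (w - y) @[w --> x + y] --> x.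
  rewrite -[X in _ --> X](addrK y); apply: cvgB; [exact: cvg_id|exact: cvg_cst].
have : \forall w \near x + y, P (w - y) := c _ Px.
apply: filterS => w Pw.
by rewrite -(subrK y w); exact: coneD.
Qed.

Lemma interior_coneZ t x : 0 < t -> interior P x -> interior P (t *: x).
Proof.
move=> t0 Px; have c : (t^-1 *: w) @[w --> t *: x] --> x.
  rewrite -[X in _ --> X](scalerK (lt0r_neq0 t0)).
  by apply: cvgZl_tmp; exact: cvg_id.
have : \forall w \near t *: x, P (t^-1 *: w) := c _ Px.
apply: filterS => w Pw.
by rewrite -(scalerKV (lt0r_neq0 t0) w); apply: coneZ => //; exact: ltW.
Qed.

Lemma cone_le_ll_trans y x z : cone_le P x y -> cone_ll P y z -> cone_ll P x z.
Proof.
rewrite /cone_le /cone_ll => xy yz.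
by rewrite -(subrKA y z); exact: interior_coneD.
Qed.

Lemma cone_llW x y : cone_ll P x y -> cone_le P x y.
Proof. exact: interior_subset. Qed.

Lemma near_cone_ll_scale (u : nat -> R) x e :
  u @ \oo --> 0 -> cone_ll P 0 e -> \forall n \near \oo, cone_ll P (u n *: x) e.
Proof.
move=> u0; rewrite /cone_ll subr0 => e0.
have c : (e - u n *: x) @[n --> \oo] --> e.
  rewrite -[X in _ --> X]subr0 -(scale0r x).
  by apply: cvgB; [exact: cvg_cst|exact: cvgZr_tmp].
by apply: c; apply: open_nbhs_nbhs; split=> //; exact: open_interior.
Qed.

(** Taking [e = e0 / (n + 1)] with [e0] interior, the points [s *: e - x] of [P] tend to [- x],
    which lies in [P] by closedness. *)
Lemma cone_le0_small s x : interior P !=set0 ->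
  (forall e, cone_ll P 0 e -> cone_le P x (s *: e)) -> cone_le P x 0.
Proof.
move=> [e0 Pe0] small; rewrite /cone_le.
apply: (@closed_cvg _ _ \oo _ (fun n => s *: (n.+1%:R^-1 *: e0) - x) P
  (cone_closed hP)).
  apply: nearW => n; apply: small.
  by rewrite /cone_ll subr0; apply: interior_coneZ => //; rewrite invr_gt0 ltr0n.
apply: cvgB; last exact: cvg_cst.
rewrite -(scaler0 _ s) -(scale0r e0); apply: cvgZl_tmp; apply: cvgZr_tmp.
exact: cvg_harmonic.
Qed.

End ConeOrder.

Section ConeMetricTheory.
Context {R : realType} {E : completeNormedModType R} {M : Type}.
Context (P : set E) (d : M -> M -> E).
Hypotheses (hP : is_cone P) (hd : is_cone_metric P d).
Implicit Types (x y z : M) (e : E).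

Lemma cone_metricxx x : d x x = 0.
Proof. exact/(cone_metric_eq0 hd). Qed.

(** Bridges convergence through [cone_ll] and the generated topology: a neighbourhood contains a
    finite intersection of subbasic balls around [x], and each of them eventually contains [u n]. *)
Lemma cone_cvg_nbhs (u : nat -> M) x (A : set (cone_top P d)) :
  cone_cvg P d u x -> nbhs (x : cone_top P d) A -> \forall n \near \oo, A (u n).
Proof.
move=> ux; rewrite nbhsE => -[B [[D DsubI <-] [F DF Fx]] BA].
have {DsubI}[I Isub IF] := DsubI _ DF.
have uF : \forall n \near \oo, F (u n).
  rewrite -IF; apply: (@filter_bigI M (set M) I id (u @ \oo)) => i iI.
  have /Isub := iI; rewrite inE => -[b [e [_ iE]]].
  have : i x by move: Fx; rewrite -IF; exact.
  rewrite iE /cone_ball /= => xb.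
  (* The ball is centred at [b], not at [x]; the slack [e - d x b] serves as radius around [x]. *)
  have [|n0 n0P] := ux (e - d x b); first by rewrite /cone_ll subr0.
  exists n0 => // n /= n0n; rewrite /cone_ball /=.
  apply: (cone_le_ll_trans hP) (cone_metric_triangle hd (u n) b x) _.
  by have := n0P _ n0n; rewrite /cone_ll addrAC -addrA -opprD.
by apply: filterS uF => n Fn; apply: BA; exists F.
Qed.

Lemma cone_continuous_cvg (f : M -> M) (u : nat -> M) x :
  cone_continuous P d f -> cone_cvg P d u x -> cone_cvg P d (f \o u) (f x).
Proof.
move=> fc ux e e0.
have fx : nbhs (f x : cone_top P d) (cone_ball P d (f x) e).
  apply: open_nbhs_nbhs; split; last first.
    by rewrite /cone_ball /= cone_metricxx.
  exists [set cone_ball P d (f x) e]; last by rewrite bigcup_set1.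
  move=> _ ->; by apply: (@finI_from1 _ _ _ id); exists (f x), e.
have [n0 _ n0P] := cone_cvg_nbhs ux (fc x _ fx).
by exists n0 => n n0n; exact: n0P.
Qed.

Lemma cone_geometric_cauchy (k : R) (v : E) (y : nat -> M) :
  0 <= k < 1 -> cone_le P 0 v ->
  (forall n, cone_le P (d (y n) (y n.+1)) (k ^+ n *: v)) -> cone_cauchy P d y.
Proof.
move=> /andP[k0 k1] v0 yk.
have k1' : 1 - k != 0 by rewrite gt_eqF// subr_gt0.
(* The geometric sum from [k ^+ n] to [k ^+ (n + m - 1)] in closed form, empty for [m = 0]. *)
have tail n m : cone_le P (d (y n) (y (n + m)%N))
    (((k ^+ n - k ^+ (n + m)) / (1 - k)) *: v).
  elim: m => [|m ih].
    by rewrite addn0 cone_metricxx subrr mul0r scale0r; exact: cone_le_refl.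
  apply: (cone_le_trans hP) (cone_metric_triangle hd _ _ (y (n + m)%N)) _.
  rewrite addnS.
  have -> : (k ^+ n - k ^+ (n + m).+1) / (1 - k) =
      (k ^+ n - k ^+ (n + m)) / (1 - k) + k ^+ (n + m).
    by rewrite exprS; field.
  by rewrite scalerDl; exact: cone_leD.
have tail' n m : (n <= m)%N ->
    cone_le P (d (y n) (y m)) ((1 - k)^-1 * k ^+ n *: v).
  move=> nm; rewrite -(subnKC nm).
  apply: (cone_le_trans hP) (tail _ _) _.
  rewrite /cone_le -scalerBl; apply: (coneZ hP); last first.
    by move: v0; rewrite /cone_le subr0.
  have -> : (1 - k)^-1 * k ^+ n - (k ^+ n - k ^+ (n + (m - n))) / (1 - k) =
      k ^+ (n + (m - n)) / (1 - k) by ring.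
  by rewrite divr_ge0 ?exprn_ge0// subr_ge0 ltW.
move=> e e0.
have geo : ((1 - k)^-1 * k ^+ n) @[n --> \oo] --> (0 : R).
  by apply: cvg_geometric; rewrite ger0_norm.
have [N _ NP] := near_cone_ll_scale v geo e0.
exists N => n m Nn Nm.
wlog nm : n m Nn Nm / (n <= m)%N => [wl|].
  have [|/ltnW] := leqP n m; first exact: wl.
  by rewrite (cone_metric_sym hd); exact: wl.
exact: (cone_le_ll_trans hP) (tail' _ _ nm) (NP _ Nn).
Qed.

End ConeMetricTheory.

Theorem theorem2p1 (R : realType) (E : completeNormedModType R) (P : set E)
    (M : Type) (d : M -> M -> E) (K : R) (S T : M -> M)
    (hP : is_cone P) (hint : interior P !=set0)
    (hnormal : normal_cone P) (hK : normal_constant P K)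
    (hd : is_cone_metric P d) (hcomplete : cone_complete P d)
    (hT : cone_continuous P d T)
    (hST : range S `<=` range T)
    (hcomm : forall x : M, S (T x) = T (S x))
    (hcontr : exists a b c : R,
      [/\ 0 <= a, 0 <= b, 0 <= c, 0 < a + 2 * b + 2 * c < 1
        & forall x y : M,
          cone_le P (d (S x) (S y))
            (a *: d (T x) (T y) + b *: (d (S x) (T x) + d (S y) (T y))
             + c *: (d (S x) (T y) + d (S y) (T y)))]) :
  exists! z : M, S z = z /\ T z = z.
Proof.
have [a [b [c [a0 b0 c0 /andP[_ abc1] contr]]]] := hcontr.
have d0 := cone_metric_ge0 hd.
have dxx := cone_metricxx hd.
have coincidence x y : S x = T x -> S y = T y -> S x = S y.
  move=> Sx Sy; apply/(cone_metric_eq0 hd).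
  (* At coincidence points the [b] terms and [d (S y) (T y)] vanish; only the [a] term and
     [d (S x) (T y)] survive. *)
  apply: (cone_le_contract0 hP (t := a + c)) => //; first by lra.
  by have := contr x y; rewrite -Sx -Sy !dxx !addr0 scaler0 addr0 -scalerDl.
suff [z Sz] : exists z, S z = T z.
  have SSz : S (S z) = S z by apply: coincidence => //; rewrite -hcomm Sz.
  exists (S z); split=> [|w [Sw Tw]]; first by rewrite -hcomm -Sz.
  by rewrite -Sw; apply: coincidence; rewrite ?Sw ?Tw.
have [g gP] : {g & forall x, T (g x) = S x}.
  apply: (@boolp.choice M M (fun x y => T y = S x)) => x.
  by have [y _ Ty] : range T (S x) by [apply: hST; exists x]; exists y.
have [x0 _] := cone_metric_nonempty hd.
pose x n := iter n g x0; pose y n := S (x n).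
have Tx n : T (x n.+1) = y n by rewrite /x iterS gP.
pose k := (1 - (b + c))^-1 * (a + b).
have bc1 : 0 < 1 - (b + c) by lra.
have k01 : 0 <= k < 1.
  rewrite /k mulr_ge0 ?invr_ge0 ?(ltW bc1) ?addr_ge0//=.
  by rewrite mulrC ltr_pdivrMr//; lra.
have yk n : cone_le P (d (y n) (y n.+1)) (k ^+ n *: d (y 0) (y 1)).
  elim: n => [|n ih]; first by rewrite expr0 scale1r; exact: cone_le_refl.
  have step : cone_le P (d (y n.+1) (y n.+2)) (k *: d (y n) (y n.+1)).
    rewrite /k -scalerA; apply: (cone_le_absorb hP); first by lra.
    (* Here [S x_(n+1) = T x_(n+2)] kills the first [c] term, and [d (y n.+1) (y n.+2)] appears on
       the right with coefficient [b + c], which is absorbed. *)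
    have := contr (x n.+1) (x n.+2); rewrite !Tx -!/(y _) dxx add0r.
    rewrite (cone_metric_sym hd (y n.+1) (y n)).
    by rewrite (cone_metric_sym hd (y n.+2)) scalerDr !scalerDl !addrA.
  apply: (cone_le_trans hP) step _; rewrite exprS -scalerA.
  by apply: (cone_leZ hP) ih; case/andP: k01.
have [z yz] := hcomplete _ (cone_geometric_cauchy hP hd k01 (d0 _ _) yk).
have Tyz := cone_continuous_cvg hP hd hT yz.
have Sy n : S (y n) = T (y n.+1) by rewrite /y -hcomm Tx.
exists z; apply/esym/(cone_metric_eq0 hd)/(cone_le0 hP) => //.
(* Error budget: [1] for [d (T z) (S (y n))], [a] for [d (T (y n)) (T z)], [2 * b] for
   [d (S (y n)) (T (y n))] passing through [T z], [c] for [d (S (y n)) (T z)]; the denominator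
   absorbs the [b + c] copies of [d (T z) (S z)]. *)
apply: (cone_le0_small hP (s := (1 - (b + c))^-1 * (1 + a + 2 * b + c))) => //.
move=> e e0; have [n nP] := Tyz e e0.
have Te m : (n <= m)%N -> cone_le P (d (T (y m)) (T z)) e.
  by move=> nm; apply: cone_llW; exact: nP.
(* Both indices are needed, since [S (y n)] is [T (y n.+1)]. *)
have {nP} Te0 := Te _ (leqnn n); have Te1 := Te _ (leqnSn n).
rewrite -scalerA; apply: (cone_le_absorb hP); first by lra.
apply: (cone_le_trans hP) (cone_metric_triangle hd _ _ (S (y n))) _.
have TT : cone_le P (d (T (y n.+1)) (T (y n))) (e + e).
  apply: (cone_le_trans hP) (cone_metric_triangle hd _ _ (T z)) _.
  by apply: (cone_leD hP) => //; rewrite (cone_metric_sym hd).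
have -> : (1 + a + 2 * b + c) *: e + (b + c) *: d (T z) (S z) =
    e + (a *: e + b *: (e + e + d (T z) (S z)) + c *: (e + d (T z) (S z))).
  rewrite !scalerDl scale1r mulr_natl mulr2n scalerDl !scalerDr !addrA.
  by rewrite [X in X + _ = _]addrAC.
apply: (cone_leD hP); first by rewrite (cone_metric_sym hd) Sy.
apply: (cone_le_trans hP) (contr (y n) z) _.
rewrite Sy (cone_metric_sym hd (S z)).
by do ![apply: (cone_leD hP)|apply: (cone_leZ hP)] => //;
  exact: cone_le_refl.
Qed.
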